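(* In the offline-to-online $K$-armed bandit setting with offline counts $\mathbf m=(m_1,\dots,m_K)$ described in the context, for any $T\ge 1$ and any algorithm $\mathcal A$, \[ \mathcal R_{\mathcal A}(T)\ge \frac{1}{31}\,T\sqrt{\max_{J\subseteq[K]}\frac{|J|}{T-1+\sum_{j\in J}m_j}} . \]
   Context: There are $K$ arms; arm $i$ has an unknown $1$-subgaussian reward distribution $\mathcal P_i$ (i.e. $\int \exp(\lambda(x-\mu_i))\mathcal P_i(dx)\le\exp(\lambda^2/2)$ for all real $\lambda$) with mean $\mu_i$. A fixed non-random vector $\mathbf m$ of nonnegative integers is given, and before interaction the learner observes $m_i$ i.i.d. samples from $\mathcal P_i$ for each $i$. An instance is $(\mathcal P_1,\dots,\mathcal P_K)$ together with $\mathbf m$; $\Theta_{\mathbf m}$ is the set of all such instances with $1$-subgaussian distributions. In online rounds $t=1,\dots,T$ the learner (algorithm $\mathcal A$, using offline data and past online observations) pulls $I(t)$ and observes an independent reward from $\mathcal P_{I(t)}$. With $\mu^*=\max_i\mu_i$, the pseudo-regret is $R(T)=T\mu^*-\sum_{t=1}^T\mu_{I(t)}$ and $\mathcal R_{\mathcal A}(T)=\sup_{\theta\in\Theta_{\mathbf m}}\mathbb E_{\theta,\mathcal A}[R(T)]$, the expectation being over offline data, online rewards and the algorithm's randomness.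
   Formalization: The formal theorem assumes K ≥ 2, since for K = 1 the regret is identically 0 and the bound fails; a ratio |J|/0 with J nonempty (possible only when T = 1) is read as +∞. *)

(* Defs.v *)
From HB Require Import structures.
From mathcomp Require Import all_boot all_order all_algebra.
From mathcomp Require Import all_classical all_reals all_analysis.
Set Implicit Arguments. Unset Strict Implicit. Unset Printing Implicit Defensive.
Import Order.TTheory GRing.Theory Num.Theory.
Local Open Scope ring_scope.
Local Open Scope ereal_scope.

Section Bandit.
Variable R : realType.
Variable K : nat.

Definition mean (P : probability R R) : R := fine (\int[P]_x (x%:E)).

Definition subgaussian1 (P : probability R R) : Prop :=
  P.-integrable setT (fun x : R => x%:E) /\
  forall lam : R,
    \int[P]_x (expR (lam * (x - mean P))%R)%:E <= (expR (lam ^+ 2 / 2)%R)%:E.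

(* A (randomized) algorithm: given the arms of all observed samples
   (offline samples first, then online pulls) and the corresponding rewards,
   it returns a probability vector over the arms for the next pull. *)
Definition policy := seq 'I_K -> seq R -> 'I_K -> R.

Definition valid_policy (pi : policy) : Prop :=
  [/\ forall s xs i, (0 <= pi s xs i)%R,
      forall s xs, (\sum_(i < K) pi s xs i = 1)%R
    & forall (s : seq 'I_K) (n : nat) (i : 'I_K),
        measurable_fun setT (fun x : n.-tuple R => pi s (val x) i)].

Definition gap (P : 'I_K -> probability R R) (i : 'I_K) : R :=
  (\big[Num.max/0%R]_(j < K) (mean (P j) - mean (P i)))%R.

Fixpoint online_regret (P : 'I_K -> probability R R) (pi : policy) (n : nat)
    (s : seq 'I_K) (xs : seq R) : \bar R :=
  match n with
  | 0 => 0
  | n'.+1 => \sum_(i < K) ((pi s xs i)%:E *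
        ((gap P i)%:E + \int[P i]_x online_regret P pi n' (rcons s i) (rcons xs x)))
  end.

Fixpoint offline_then_online (P : 'I_K -> probability R R) (pi : policy) (T : nat)
    (arms : seq 'I_K) (s : seq 'I_K) (xs : seq R) : \bar R :=
  match arms with
  | [::] => online_regret P pi T s xs
  | i :: arms' => \int[P i]_x offline_then_online P pi T arms' (rcons s i) (rcons xs x)
  end.

Definition offline_arms (m : 'I_K -> nat) : seq 'I_K :=
  flatten [seq nseq (m i) i | i <- enum 'I_K].

Definition expected_regret (m : 'I_K -> nat) (T : nat) (pi : policy)
    (P : 'I_K -> probability R R) : \bar R :=
  offline_then_online P pi T (offline_arms m) [::] [::].

Definition minimax_regret (m : 'I_K -> nat) (T : nat) (pi : policy) : \bar R :=
  ereal_sup [set expected_regret m T pi P |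
             P in [set P : 'I_K -> probability R R | forall i, subgaussian1 (P i)]].

Definition denomJ (m : 'I_K -> nat) (T : nat) (J : {set 'I_K}) : nat :=
  (T.-1 + \sum_(j in J) m j)%N.

(* (1/31) T sqrt(max_J |J| / (T-1+sum_J m_j)); a nonempty J with zero
   denominator makes the ratio +oo (the empty J contributes 0). *)
Definition lower_bound (m : 'I_K -> nat) (T : nat) : \bar R :=
  if [exists J : {set 'I_K}, (J != finset.set0) && (denomJ m T J == 0%N)] then +oo
  else ((T%:R * Num.sqrt (\big[Num.max/0%R]_(J : {set 'I_K})
                      (#|J|%:R / (denomJ m T J)%:R)%R)) / 31%:R)%R%:E.

End Bandit.

(* Main.v *)
Require Import Defs.
From HB Require Import structures.
From mathcomp Require Import all_boot all_order all_algebra.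
From mathcomp Require Import all_classical all_reals all_analysis.
From mathcomp Require Import measurable_realfun ring lra.
Import Order.TTheory GRing.Theory Num.Theory.
Local Open Scope ring_scope.
Local Open Scope ereal_scope.

(* All hard instances have two-point reward laws, so that expectations along a
   run are finite sums.  Fix J and put D = T - 1 + sum_(j in J) m_j.

   If |J| > D, take all arms constant 0: some arm j of J is then unseen with
   positive probability before the last round, and making it constant +L or -L
   forces a regret of order L, so the minimax regret is infinite.

   If |J| <= D, use arms supported on +-a with a = 16/31 and bias 0, or
   d = sqrt (|J| / D) / 2 for one distinguished arm j of J.  With the concave
   potential phi u = u (2 - u), an event of probability p under the unbiased
   instance has probability q with phi q >= p - d^2 N_j under the biased one,
   where N_j is the expected number of observations of j in the unbiased
   instance.  As the N_j sum to at most D over J, averaging over j gives regret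
   at least a d T / 8 = T sqrt (|J| / D) / 31.  The value of a is small enough
   for these laws to be 1-subgaussian by elementary estimates. *)

(** * Two-point reward laws *)

Section TwoPointArms.
Local Open Scope ring_scope.
Set Implicit Arguments.
Unset Strict Implicit.
Context (R : realType).

(** The two outcomes may coincide, so constant rewards are included. *)
Record arm := Arm { weight : R; hi : R; lo : R; weight01 : 0 <= weight <= 1 }.

Definition expect (a : arm) (f : R -> R) : R :=
  weight a * f (hi a) + (1 - weight a) * f (lo a).

Definition arm_value (a : arm) (b : bool) : R := if b then hi a else lo a.

Lemma measurable_arm_value (a : arm) : measurable_fun setT (arm_value a).
Proof. by []. Qed.

HB.instance Definition _ (a : arm) :=
  isMeasurableFun.Build _ _ _ _ (arm_value a) (measurable_arm_value a).

Definition arm_law (a : arm) : probability R R :=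
  distribution (bernoulli_prob (weight a)) (arm_value a).

Lemma arm_integrable (a : arm) (f : R -> R) : measurable_fun setT f ->
  (arm_law a).-integrable setT (fun x : R => (f x)%:E).
Proof.
move=> mf; have mEf : measurable_fun setT (fun x : R => (f x)%:E) by exact/measurable_EFinP.
apply/integrableP; split => //.
rewrite ge0_integral_distribution //; last exact: measurableT_comp.
by rewrite integral_bernoulli_prob ?weight01//= ltey.
Qed.

Lemma integral_arm_law (a : arm) (f : R -> R) : measurable_fun setT f ->
  (\int[arm_law a]_x (f x)%:E = (expect a f)%:E)%E.
Proof.
move=> mf; have mEf : measurable_fun setT (fun x : R => (f x)%:E) by exact/measurable_EFinP.
rewrite integralE ge0_integral_distribution//; last exact: measurable_funepos.
rewrite ge0_integral_distribution//; last exact: measurable_funeneg.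
rewrite !integral_bernoulli_prob ?weight01//=.
rewrite !funeposE !funenegE/= /expect.
rewrite -!EFin_max -!EFinM -!EFinD /unstable.onem; congr EFin.
have maxE (r : R) : r = Num.max r 0 - Num.max (- r) 0.
  by rewrite /Num.max; case: ifPn => ?; case: ifPn => ?; lra.
by rewrite [f (hi a) in RHS]maxE [f (lo a) in RHS]maxE; ring.
Qed.

Lemma mean_arm_law (a : arm) : mean (arm_law a) = expect a id.
Proof. by rewrite /mean integral_arm_law//; exact: measurable_id. Qed.

Lemma subgaussian1_arm_law (a : arm) :
  (forall l, expect a (fun x => expR (l * (x - expect a id))) <= expR (l ^+ 2 / 2)) ->
  subgaussian1 (arm_law a).
Proof.
move=> sub; split; first exact: arm_integrable.
move=> l; rewrite mean_arm_law integral_arm_law ?lee_fin//.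
apply: measurableT_comp => //.
by apply: measurable_funM => //; apply: measurable_funB.
Qed.

End TwoPointArms.

(** * Runs of a policy over finitely supported arms *)

Section Expect.
Local Open Scope ring_scope.
Set Implicit Arguments.
Unset Strict Implicit.
Context {R : realType}.
Implicit Types (a : arm R) (f g : R -> R).

Lemma expect_le a f g : (forall x, f x <= g x) -> expect a f <= expect a g.
Proof.
move=> fg; have /andP[w0 w1] := weight01 a.
by rewrite lerD// ler_wpM2l// subr_ge0.
Qed.

Lemma expect_affine a f (c d : R) :
  expect a (fun x => c * f x + d) = c * expect a f + d.
Proof. by rewrite /expect; ring. Qed.

Lemma expect_sum a (I : Type) (r : seq I) (P : pred I) (F : I -> R -> R) :
  expect a (fun x => \sum_(i <- r | P i) F i x) =
  \sum_(i <- r | P i) expect a (F i).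
Proof. by rewrite /expect big_split/= -!mulr_sumr. Qed.

Lemma expect_cst a (c : R) : expect a (fun=> c) = c.
Proof. by rewrite /expect; ring. Qed.

End Expect.

Section FiniteRun.
Local Open Scope ring_scope.
Set Implicit Arguments.
Unset Strict Implicit.
Context {R : realType} {K : nat}.
Implicit Types (A : 'I_K -> arm R) (ps : seq (policy R K)).
Implicit Types (G H : seq 'I_K -> seq R -> R) (s : seq 'I_K) (xs : seq R).

(** Expectation of [G] at the final history. One policy per round is listed, so that forced offline
    samples and online rounds fall under the same induction. *)
Fixpoint run A ps G s xs : R :=
  if ps is p :: ps' then
    \sum_(i < K) p s xs i *
      expect (A i) (fun x => run A ps' G (rcons s i) (rcons xs x))
  else G s xs.

Fixpoint pulls A (j : 'I_K) ps s xs : R :=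
  if ps is p :: ps' then
    \sum_(i < K) p s xs i * ((i == j)%:R +
      expect (A i) (fun x => pulls A j ps' (rcons s i) (rcons xs x)))
  else 0.

Definition valid_policies ps := all (fun p => `[< valid_policy p >]) ps.

Lemma policy_ge0 p s xs i : valid_policy p -> 0 <= p s xs i :> R.
Proof. by case. Qed.

Lemma policy_sum1 p s xs : valid_policy p -> \sum_(i < K) p s xs i = 1 :> R.
Proof. by case. Qed.

Lemma run_le A ps G H : valid_policies ps ->
  (forall s xs, G s xs <= H s xs) -> forall s xs, run A ps G s xs <= run A ps H s xs.
Proof.
elim: ps => [|p ps IH]/= => [_ GH|/andP[/asboolP vp vps] GH] s xs; first exact: GH.
apply: ler_sum => i _; rewrite ler_wpM2l ?policy_ge0//.
by apply: expect_le => x; exact: IH.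
Qed.

Lemma run_affine A ps G (c d : R) : valid_policies ps -> forall s xs,
  run A ps (fun s xs => c * G s xs + d) s xs = c * run A ps G s xs + d.
Proof.
elim: ps => [//|p ps IH]/= /andP[/asboolP vp vps] s xs.
rewrite mulr_sumr -[d in RHS]mul1r -(policy_sum1 s xs vp) mulr_suml -big_split/=.
apply: eq_bigr => i _; rewrite mulrCA -mulrDr -expect_affine; congr (_ * _).
by congr expect; apply/funext => x; rewrite IH.
Qed.

Lemma run_cst A ps (d : R) s xs : valid_policies ps ->
  run A ps (fun _ _ => d) s xs = d.
Proof.
move=> vps; transitivity (0 * run A ps (fun _ _ => 0) s xs + d).
  rewrite -run_affine//; congr run.
  by apply/funext => ?; apply/funext => ?; rewrite mul0r add0r.
by rewrite mul0r add0r.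
Qed.

Lemma run_sum A ps (I : Type) (r : seq I) (P : pred I)
    (F : I -> seq 'I_K -> seq R -> R) : forall s xs,
  run A ps (fun s xs => \sum_(i <- r | P i) F i s xs) s xs =
  \sum_(i <- r | P i) run A ps (F i) s xs.
Proof.
elim: ps => [//|p ps IH] s xs /=.
rewrite exchange_big/=; apply: eq_bigr => i _.
rewrite -mulr_sumr -expect_sum; congr (_ * expect _ _).
by apply/funext => x; rewrite IH.
Qed.

Lemma run01 A ps G : valid_policies ps ->
  (forall s xs, 0 <= G s xs <= 1) -> forall s xs, 0 <= run A ps G s xs <= 1.
Proof.
move=> vps G01 s xs.
rewrite -{1}(run_cst A 0 s xs vps) -(run_cst A 1 s xs vps).
by apply/andP; split; apply: run_le => // s' xs'; case/andP: (G01 s' xs').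
Qed.

Lemma pulls_ge0 A j ps : valid_policies ps ->
  forall s xs, 0 <= pulls A j ps s xs.
Proof.
elim: ps => [//|p ps IH]/= /andP[/asboolP vp vps] s xs.
apply: sumr_ge0 => i _; rewrite mulr_ge0 ?policy_ge0// addr_ge0//.
by rewrite -(expect_cst (A i) 0); apply: expect_le => x; exact: IH.
Qed.

Definition deterministic (i : 'I_K) : policy R K := fun _ _ j => (i == j)%:R.

Lemma valid_deterministic i : valid_policy (deterministic i).
Proof.
split => [s xs j|s xs|s n j]; first by rewrite /deterministic.
  rewrite /deterministic (bigD1 i)//= eqxx big1 ?addr0// => j.
  by rewrite eq_sym => /negbTE ->.
exact: measurable_cst.
Qed.

Lemma sum_deterministic i s xs (F : 'I_K -> R) :
  \sum_(j < K) deterministic i s xs j * F j = F i.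
Proof.
rewrite (bigD1 i)//= /deterministic eqxx mul1r big1 ?addr0// => j.
by rewrite eq_sym => /negbTE ->; rewrite mul0r.
Qed.

(** Each offline sample is a round whose policy is forced to choose the prescribed arm. *)
Definition schedule (arms : seq 'I_K) (t : nat) (p : policy R K) :=
  map deterministic arms ++ nseq t p.

Lemma valid_schedule arms t p : valid_policy p -> valid_policies (schedule arms t p).
Proof.
move=> vp; rewrite /valid_policies all_cat all_map all_nseq; apply/andP; split.
  by apply/allP => i _; apply/asboolP; exact: valid_deterministic.
by apply/orP; right; apply/asboolP.
Qed.

(** A forced round contributes exactly when its arm lies in [J]; an online round pulls a single arm,
    so it contributes at most 1. *)
Lemma sum_pulls_schedule A (J : {set 'I_K}) arms t p : valid_policy p ->
  forall s xs, \sum_(j in J) pulls A j (schedule arms t p) s xs <=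
    (count (mem J) arms + t)%:R.
Proof.
have indic i : \sum_(j in J) (i == j)%:R = (i \in J)%:R :> R.
  have [iJ|iJ] := boolP (i \in J); last first.
    by rewrite big1// => j jJ; case: eqP => // ij; rewrite ij jJ in iJ.
  rewrite (bigD1 i)//= eqxx big1 ?addr0// => j /andP[_].
  by rewrite eq_sym => /negbTE ->.
move=> vp; elim: arms => [|i arms IH] s xs /=; last first.
  under eq_bigr do rewrite sum_deterministic.
  rewrite big_split/= indic -expect_sum -addnA natrD lerD2l.
  by rewrite -[leRHS](expect_cst (A i)); apply: expect_le => x; exact: IH.
rewrite add0n; elim: t s xs => [|t IH] s xs /=; first by rewrite big1.
have -> : t.+1%:R = \sum_(i < K) p s xs i * t.+1%:R :> R.
  by rewrite -mulr_suml policy_sum1// mul1r.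
rewrite exchange_big/=; apply: ler_sum => i _; rewrite -mulr_sumr ler_wpM2l ?policy_ge0//.
rewrite big_split/= indic -expect_sum -add1n natrD lerD//; first by case: (_ \in _).
by rewrite -[leRHS](expect_cst (A i)); apply: expect_le => x; exact: IH.
Qed.

End FiniteRun.

(** * Comparison of one policy under two instances *)

Section ChangeOfMeasure.
Local Open Scope ring_scope.
Set Implicit Arguments.
Unset Strict Implicit.
Context {R : realType} {K : nat}.
Implicit Types (G : seq 'I_K -> seq R -> R) (ps : seq (policy R K)).

(** This is [1 - (1 - u)^2]. It satisfies [u <= phi u] on [0, 1] and [phi u <= 2 u] everywhere,
    which converts it back to probabilities. *)
Definition phi (u : R) : R := u * (2 - u).

Lemma phi_jensen (I : finType) (w u : I -> R) :
  (forall i, 0 <= w i) -> \sum_i w i = 1 ->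
  \sum_i w i * phi (u i) <= phi (\sum_i w i * u i).
Proof.
move=> w0 w1; set m := \sum_i _ * u i.
(* Tangent line at the mean [m]: its linear part averages to zero, and [phi] lies below it by
   [(u i - m)^2]. *)
have -> : phi m = \sum_i w i * (phi m + (2 - 2 * m) * (u i - m)).
  have E i : w i * (phi m + (2 - 2 * m) * (u i - m)) =
      w i * (phi m - (2 - 2 * m) * m) + (2 - 2 * m) * (w i * u i) by ring.
  under eq_bigr => i _ do rewrite E.
  by rewrite big_split/= -mulr_suml -mulr_sumr w1 -/m; ring.
apply: ler_sum => i _; rewrite ler_wpM2l// /phi.
by have := sqr_ge0 (u i - m); nra.
Qed.

Lemma expect_phi_le (a : arm R) (f : R -> R) :
  expect a (phi \o f) <= phi (expect a f).
Proof.
have /andP[w0 w1] := weight01 a; rewrite /expect/= /phi.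
set w := weight a in w0 w1 *; set u := f (hi a); set v := f (lo a).
(* For a quadratic potential the Jensen gap is exactly the variance. *)
have -> : (w * u + (1 - w) * v) * (2 - (w * u + (1 - w) * v)) =
   w * (u * (2 - u)) + (1 - w) * (v * (2 - v)) + w * (1 - w) * (u - v) ^+ 2 by ring.
rewrite lerDl; apply: mulr_ge0; last exact: sqr_ge0.
by rewrite mulr_ge0// subr_ge0.
Qed.

(* A Pinsker-type inequality with a polynomial potential: the concavity of
   [phi] pays for the change of arm [j], at the price [l] per pull of [j]. *)
Lemma run_change_arm (A B : 'I_K -> arm R) (j : 'I_K) (l : R) ps G :
  (forall i, i != j -> B i = A i) ->
  (forall f : R -> R, (forall x, 0 <= f x <= 1) ->
     expect (A j) (phi \o f) - l <= phi (expect (B j) f)) ->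
  valid_policies ps -> (forall s xs, 0 <= G s xs <= 1) ->
  forall s xs, run A ps (fun s xs => phi (G s xs)) s xs - l * pulls A j ps s xs
    <= phi (run B ps G s xs).
Proof.
move=> AB Bj; elim: ps => [|p ps IH]/= => [_ G01|/andP[/asboolP vp vps] G01] s xs.
  by rewrite mulr0 subr0.
(* Concavity takes [phi] inside the average over the chosen arm, leaving a comparison arm by arm. *)
apply: (le_trans _ (phi_jensen _ _ _)); last 2 first.
- by move=> i; exact: policy_ge0.
- exact: policy_sum1.
rewrite mulr_sumr -sumrB; apply: ler_sum => i _.
rewrite mulrCA -mulrBr ler_wpM2l ?policy_ge0//.
pose f x := run B ps G (rcons s i) (rcons xs x).
have step : expect (A i) (fun x => run A ps (fun s xs => phi (G s xs)) (rcons s i) (rcons xs x)) -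
    l * expect (A i) (fun x => pulls A j ps (rcons s i) (rcons xs x)) <=
    expect (A i) (phi \o f).
  apply: (@le_trans _ _ (expect (A i) (fun x =>
    run A ps (fun s xs => phi (G s xs)) (rcons s i) (rcons xs x) -
    l * pulls A j ps (rcons s i) (rcons xs x)))).
    by rewrite /expect le_eqVlt; apply/orP; left; apply/eqP; ring.
  by apply: expect_le => x; exact: IH.
(* Away from [j] the laws agree and concavity is enough; at [j] the unit counted by [pulls] pays the
   price [l]. *)
have [ij|ij] := eqVneq i j; last first.
  rewrite add0r; apply: (le_trans step).
  by rewrite AB//; exact: expect_phi_le.
subst j; apply: (le_trans _ (Bj f _)); last by move=> x; exact: run01.
by move: step; set X := expect _ _; set Y := expect _ _; set Z := expect _ _; rewrite /=; lra.
Qed.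

(* As long as arm [j] is not pulled, the two instances produce the same history. *)
Lemma run_unseen_arm (A B C : 'I_K -> arm R) (j : 'I_K) ps G :
  (forall i, i != j -> B i = A i) -> (forall i, i != j -> C i = A i) ->
  valid_policies ps -> (forall s xs, 0 <= G s xs <= 1) ->
  forall s xs, 1 - pulls A j ps s xs <=
    run B ps G s xs + run C ps (fun s xs => 1 - G s xs) s xs.
Proof.
move=> AB AC; elim: ps => [|p ps IH]/= => [_ G01|/andP[/asboolP vp vps] G01] s xs.
  by rewrite subr0 addrC subrK.
rewrite -{1}(policy_sum1 s xs vp) -sumrB -big_split/=; apply: ler_sum => i _.
rewrite -mulrDr -[X in X - _]mulr1 -mulrBr ler_wpM2l ?policy_ge0//.
(* A pull of [j] makes the left side nonpositive and the right side is nonnegative; for any other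
   arm the three laws agree and the induction hypothesis applies. *)
have [->|ij] := eqVneq i j; last first.
  rewrite AB// AC// add0r.
  apply: (@le_trans _ _ (expect (A i) (fun x =>
    1 - pulls A j ps (rcons s i) (rcons xs x)))).
    by rewrite /expect le_eqVlt; apply/orP; left; apply/eqP; ring.
  apply: (@le_trans _ _ (expect (A i) (fun x => run B ps G (rcons s i) (rcons xs x) +
    run C ps (fun s xs => 1 - G s xs) (rcons s i) (rcons xs x)))).
    by apply: expect_le => x; exact: IH.
  by rewrite /expect le_eqVlt; apply/orP; left; apply/eqP; ring.
have e0 (a : arm R) (f : R -> R) : (forall x, 0 <= f x) -> 0 <= expect a f.
  by move=> f0; rewrite -(expect_cst a 0); exact: expect_le.
have h1 : 0 <= expect (B j) (fun x => run B ps G (rcons s j) (rcons xs x)).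
  by apply: e0 => x; case/andP: (run01 B vps G01 (rcons s j) (rcons xs x)).
have h2 : 0 <= expect (C j) (fun x =>
    run C ps (fun s xs => 1 - G s xs) (rcons s j) (rcons xs x)).
  apply: e0 => x; have /andP[]// : 0 <= run C ps (fun s xs => 1 - G s xs) (rcons s j) (rcons xs x) <= 1.
  apply: run01 => // s' xs'; have := G01 s' xs'; lra.
have h3 : 0 <= expect (A j) (fun x => pulls A j ps (rcons s j) (rcons xs x)).
  by apply: e0 => x; exact: pulls_ge0.
rewrite /=; lra.
Qed.

End ChangeOfMeasure.

(** * Regret as a finite sum *)

Section RegretOfArms.
Local Open Scope ring_scope.
Set Implicit Arguments.
Unset Strict Implicit.
Context {R : realType} {K : nat}.

Lemma measurable_rcons d (T : measurableType d) n (f : T -> n.-tuple R) (g : T -> R) :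
  measurable_fun setT f -> measurable_fun setT g ->
  measurable_fun setT (fun x => [tuple of rcons (f x) (g x)]).
Proof.
move=> mf mg; apply/measurable_fun_tnthP => i.
have [lt_in|le_ni] := ltnP i n.
  rewrite (_ : _ \o _ = fun x => tnth (f x) (Ordinal lt_in)).
    by apply: (measurableT_comp (measurable_tnth _)).
  apply/funext => x /=; rewrite !(tnth_nth 0)/= nth_rcons size_tuple lt_in.
  by [].
rewrite (_ : _ \o _ = g)//; apply/funext => x /=.
rewrite (tnth_nth 0)/= nth_rcons size_tuple ltnNge le_ni/=.
by rewrite eqn_leq le_ni -ltnS ltn_ord.
Qed.

(** Stated length by length through tuples, in the form used by [valid_policy], and hence compatible
    with appending a reward. *)
Definition measurable_history (G : seq 'I_K -> seq R -> R) :=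
  forall s n, measurable_fun setT (fun xs : n.-tuple R => G s xs).

Lemma measurable_history_rcons G s (xs : seq R) : measurable_history G ->
  measurable_fun setT (fun x : R => G s (rcons xs x)).
Proof.
move=> mG; exact: (measurableT_comp (mG s (size xs).+1)
  (measurable_rcons (measurable_cst (in_tuple xs)) (@measurable_id _ _ _))).
Qed.

Lemma measurable_run (A : 'I_K -> arm R) (ps : seq (policy R K)) G :
  valid_policies ps -> measurable_history G -> measurable_history (run A ps G).
Proof.
move=> + mG; elim: ps => [//|p ps IH]/= /andP[/asboolP[_ _ mp] vps] s n.
apply: measurable_sum => i; apply: measurable_funM; first exact: mp.
have m x : measurable_fun setT (fun xs : n.-tuple R => run A ps G (rcons s i) (rcons xs x)).
  exact: (measurableT_comp (IH vps (rcons s i) n.+1)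
    (measurable_rcons (@measurable_id _ _ _) (measurable_cst x))).
by apply: measurable_funD; apply: measurable_funM.
Qed.

Variables (A : 'I_K -> arm R) (pi : policy R K) (vpi : valid_policy pi).
Let P i := arm_law (A i).

Definition round_regret (s : seq 'I_K) (xs : seq R) : R :=
  \sum_(i < K) pi s xs i * gap P i.

Lemma measurable_round_regret : measurable_history round_regret.
Proof.
case: vpi => _ _ mpi s n; apply: measurable_sum => i.
by apply: measurable_funM => //; exact: mpi.
Qed.

(** Linearity of expectation unrolls the recursion into one term per round; term [t] is evaluated
    after [t] online pulls, so the last one follows [n - 1] of them. *)
Lemma online_regretE n s xs : online_regret P pi n s xs =
  (\sum_(t < n) run A (schedule [::] t pi) round_regret s xs)%:E.
Proof.
elim: n s xs => [|n IH] s xs /=; first by rewrite big_ord0.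
rewrite big_ord_recl exchange_big/= /round_regret -big_split/= -sumEFin.
apply: eq_bigr => i _; rewrite -mulr_sumr -mulrDr EFinM EFinD; congr (_ * (_ + _))%E.
under eq_integral do rewrite IH.
rewrite integral_arm_law ?expect_sum//.
apply: measurable_sum => t; apply: measurable_history_rcons.
by apply: measurable_run; [exact: (valid_schedule [::])|exact: measurable_round_regret].
Qed.

Lemma offline_then_onlineE T arms s xs : offline_then_online P pi T arms s xs =
  (\sum_(t < T) run A (schedule arms t pi) round_regret s xs)%:E.
Proof.
elim: arms s xs => [|i arms IH] s xs /=; first exact: online_regretE.
under eq_integral do rewrite IH.
rewrite integral_arm_law.
  rewrite expect_sum; congr (_%:E); apply: eq_bigr => t _.
  by rewrite sum_deterministic.
apply: measurable_sum => t; apply: measurable_history_rcons.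
by apply: measurable_run; [exact: valid_schedule|exact: measurable_round_regret].
Qed.

Lemma expected_regretE (m : 'I_K -> nat) T : expected_regret m T pi P =
  (\sum_(t < T) run A (schedule (offline_arms m) t pi) round_regret [::] [::])%:E.
Proof. exact: offline_then_onlineE. Qed.

Lemma gap_ge0 i : 0 <= gap P i.
Proof. by rewrite /gap; elim/big_rec: _ => // j x _ x0; rewrite le_max x0 orbT. Qed.

Lemma gap_ge i j : expect (A j) id - expect (A i) id <= gap P i.
Proof.
by rewrite -!mean_arm_law /gap (bigmax_sup j).
Qed.

Lemma round_regret_ge0 s xs : 0 <= round_regret s xs.
Proof. by apply: sumr_ge0 => i _; rewrite mulr_ge0 ?gap_ge0 ?policy_ge0. Qed.

Lemma round_regret_ge (j : 'I_K) c s xs :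
  (forall i, i != j -> c <= gap P i) -> c * (1 - pi s xs j) <= round_regret s xs.
Proof.
move=> gapc; rewrite -(policy_sum1 s xs vpi) /round_regret (bigD1 j)//= addrAC subrr add0r.
rewrite [leRHS](bigD1 j)//= mulr_sumr ler_wpDl ?mulr_ge0 ?gap_ge0 ?policy_ge0//.
by apply: ler_sum => i ij; rewrite mulrC ler_wpM2l ?policy_ge0// gapc.
Qed.

Lemma round_regret_ge_arm (j : 'I_K) s xs : gap P j * pi s xs j <= round_regret s xs.
Proof.
rewrite /round_regret (bigD1 j)//= mulrC lerDl.
by apply: sumr_ge0 => i _; rewrite mulr_ge0 ?gap_ge0 ?policy_ge0.
Qed.

End RegretOfArms.

Section OfflineArms.
Set Implicit Arguments.
Unset Strict Implicit.
Context {K : nat}.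

Lemma count_offline_arms (m : 'I_K -> nat) (J : {set 'I_K}) :
  count (mem J) (offline_arms m) = (\sum_(j in J) m j)%N.
Proof.
rewrite /offline_arms count_flatten -map_comp sumnE big_map big_enum/=.
rewrite [RHS]big_mkcond/=; apply: eq_big => // i _ /=.
by rewrite count_nseq/=; case: (i \in J); rewrite ?mul1n.
Qed.

End OfflineArms.

(** * Subgaussian instances *)

Section Rademacher.
Local Open Scope ring_scope.
Set Implicit Arguments.
Unset Strict Implicit.
Context {R : realType}.
Implicit Types x b u : R.

(** Square of [1 - x / 2 <= expR (- (x / 2))], whose left side is positive for [x < 2]. *)
Lemma expR_mul_sqr_le1 x : x < 2 -> expR x * (1 - x / 2) ^+ 2 <= 1.
Proof.
move=> x2.
have E : expR x * expR (- (x / 2)) ^+ 2 = 1.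
  by rewrite expr2 -!expRD -[RHS]expR0; congr expR; lra.
rewrite -[leRHS]E ler_wpM2l ?expR_ge0//; apply: lerXn2r; rewrite ?nnegrE ?expR_ge0//.
  by lra.
by have := expR_ge1Dx (- (x / 2)); lra.
Qed.

(** For [|x| >= 3/4] both exponents are at most [|x| <= 4/3 x^2]. For smaller [x], with [y = x^2],
    the rational bounds on [expR] give [cosh x <= (1 + y/4) / (1 - y/4)^2 <= 1 + 4/3 y]. *)
Lemma cosh_le x : (expR x + expR (- x)) / 2 <= expR (4 / 3 * x ^+ 2).
Proof.
have [x34|x34] := leP (3 / 4) `|x|.
  have le_e u : `|u| = `|x| -> expR u <= expR (4 / 3 * x ^+ 2).
    move=> ux; rewrite ler_expR (le_trans (ler_norm u))// ux -real_normK ?num_real//.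
    by nra.
  by have := le_e x erefl; have := le_e (- x) (normrN x); lra.
move: x34; rewrite ltr_norml => /andP[x1 x2].
have ex := @expR_mul_sqr_le1 x ltac:(lra).
have eNx := @expR_mul_sqr_le1 (- x) ltac:(lra).
have := expR_ge1Dx (4 / 3 * x ^+ 2); set E := expR (4 / 3 * _) => EE.
move: ex eNx; set e := expR x; set f := expR (- x) => ex fx.
have y0 : 0 <= x ^+ 2 < 9 / 16 by rewrite sqr_ge0/=; nra.
apply: (le_trans _ EE); set y := x ^+ 2 in y0 *.
have p0 : 0 < (1 - y / 4) ^+ 2 by apply: exprn_gt0; lra.
rewrite -(ler_pM2r p0).
apply: (@le_trans _ _ (1 + y / 4)); last by nra.
have h1 := sqr_ge0 (1 + x / 2); have h2 := sqr_ge0 (1 - x / 2).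
have h3 : e * (1 - y / 4) ^+ 2 <= (1 + x / 2) ^+ 2.
  have -> : e * (1 - y / 4) ^+ 2 = e * (1 - x / 2) ^+ 2 * (1 + x / 2) ^+ 2.
    by rewrite /y; field.
  by rewrite ler_piMl.
have h4 : f * (1 - y / 4) ^+ 2 <= (1 - x / 2) ^+ 2.
  have -> : f * (1 - y / 4) ^+ 2 = f * (1 - - x / 2) ^+ 2 * (1 - x / 2) ^+ 2.
    by rewrite /y; field.
  by rewrite ler_piMl.
have -> : (e + f) / 2 * (1 - y / 4) ^+ 2 =
  (e * (1 - y / 4) ^+ 2 + f * (1 - y / 4) ^+ 2) / 2 by field.
rewrite /y; move: h3 h4; nra.
Qed.

(** This is [tanh x <= x + x^2] cleared of its denominator, for [x] of either sign. *)
Lemma sinh_le x :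
  expR x - expR (- x) <= (expR x + expR (- x)) * (x + x ^+ 2).
Proof.
suff : expR x * (1 - x - x ^+ 2) <= expR (- x) * (1 + x + x ^+ 2) by lra.
have e0 := expR_ge0 x; have f0 := expR_ge0 (- x).
have [neg|pos] := leP (1 - x - x ^+ 2) 0.
  by apply: (@le_trans _ _ 0); [rewrite mulr_ge0_le0|rewrite mulr_ge0//; nra].
have x1 : x < 1 by nra.
have e1 : expR x * (1 - x) <= 1.
  by rewrite -[leRHS](expRxMexpNx_1 x) ler_wpM2l//; have := expR_ge1Dx (- x); lra.
(* It remains to check [1 - x - x^2 <= (1 - x)^2 (1 + x + x^2)]. *)
have e2 : expR x * (1 - x) ^+ 2 <= expR (- x).
  apply: (@le_trans _ _ (1 - x)); last by have := expR_ge1Dx (- x); lra.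
  by rewrite expr2 mulrA ler_piMl//; lra.
apply: (@le_trans _ _ (expR x * (1 - x) ^+ 2 * (1 + x + x ^+ 2))).
  rewrite -mulrA ler_wpM2l// -subr_ge0.
  have -> : (1 - x) ^+ 2 * (1 + x + x ^+ 2) - (1 - x - x ^+ 2) =
    x ^+ 2 * ((x - 1 / 2) ^+ 2 + 3 / 4) by field.
  by rewrite mulr_ge0 ?sqr_ge0// addr_ge0 ?sqr_ge0//; lra.
by rewrite ler_wpM2r//; nra.
Qed.

(** The left side is [cosh x (1 + b tanh x)]. Since [b <= 1/2], the exponents from [cosh_le] and
    [sinh_le] add up with [4/3 + 1/2 = 11/6]. *)
Lemma rademacher_mgf_le b x : 0 <= b <= 2^-1 ->
  (1 + b) / 2 * expR x + (1 - (1 + b) / 2) * expR (- x) <=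
  expR (x * b + 11 / 6 * x ^+ 2).
Proof.
move=> /andP[b0 b1].
have C0 : 0 <= (expR x + expR (- x)) / 2.
  by rewrite divr_ge0// addr_ge0// expR_ge0.
apply: (@le_trans _ _ ((expR x + expR (- x)) / 2 * (1 + b * (x + x ^+ 2)))).
  by have := ler_wpM2l b0 (sinh_le x); lra.
apply: (@le_trans _ _ (expR (4 / 3 * x ^+ 2) * expR (b * (x + x ^+ 2)))).
  apply: (@le_trans _ _ ((expR x + expR (- x)) / 2 * expR (b * (x + x ^+ 2)))).
    by rewrite ler_wpM2l// expR_ge1Dx.
  by rewrite ler_wpM2r ?expR_ge0// cosh_le.
rewrite -expRD ler_expR; have := sqr_ge0 x; nra.
Qed.

(** Chosen so that [scale / 16 = 1/31], while [11/6 scale^2 <= 1/2] still yields 1-subgaussian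
    laws. *)
Definition scale : R := 16 / 31.

Lemma scale_gt0 : 0 < scale.
Proof. by rewrite /scale divr_gt0. Qed.

Lemma biased_weight01 b : 0 <= b <= 2^-1 -> 0 <= (1 + b) / 2 <= 1.
Proof. by move=> ?; lra. Qed.

Definition biased b (b01 : 0 <= b <= 2^-1) : arm R :=
  Arm scale (- scale) (biased_weight01 b01).

Lemma expect_biased b (b01 : 0 <= b <= 2^-1) : expect (biased b01) id = scale * b.
Proof. by rewrite /expect/=; field. Qed.

Lemma subgaussian1_biased b (b01 : 0 <= b <= 2^-1) :
  subgaussian1 (arm_law (biased b01)).
Proof.
apply: subgaussian1_arm_law => l; rewrite expect_biased /expect/=.
set x := l * scale.
have -> : expR (l * (scale - scale * b)) = expR x * expR (- (x * b)).
  by rewrite -expRD; congr expR; rewrite /x; ring.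
have -> : expR (l * (- scale - scale * b)) = expR (- x) * expR (- (x * b)).
  by rewrite -expRD; congr expR; rewrite /x; ring.
rewrite !mulrA -mulrDl.
apply: (@le_trans _ _ (expR (x * b + 11 / 6 * x ^+ 2) * expR (- (x * b)))).
  by rewrite ler_wpM2r ?expR_ge0// rademacher_mgf_le.
rewrite -expRD ler_expR /x /scale; have := sqr_ge0 l; nra.
Qed.

(* The loss [d ^+ 2] is the chi-square divergence of the two laws. *)
Lemma change_biased (b01 : 0 <= (0 : R) <= 2^-1) d (d01 : 0 <= d <= 2^-1) (f : R -> R) :
  (forall x, 0 <= f x <= 1) ->
  expect (biased b01) (phi \o f) - d ^+ 2 <= phi (expect (biased d01) f).
Proof.
move=> f01; rewrite /expect /phi/=.
have := f01 scale; have := f01 (- scale).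
set u := f _; set v := f _ => /andP[u0 u1] /andP[v0 v1].
rewrite -subr_ge0.
(* [m] is the unbiased mean of [f] and [m + d w] the biased one. Completing the square leaves
   [w^2 + (1 - m)^2 <= 1], true since [u] and [v] lie in [0, 1]. *)
pose m := (u + v) / 2; pose w := (v - u) / 2.
have -> : (1 + d) / 2 * v + (1 - (1 + d) / 2) * u = m + d * w by rewrite /m/w; field.
have -> : (m + d * w) * (2 - (m + d * w)) -
    ((1 + 0) / 2 * (v * (2 - v)) + (1 - (1 + 0) / 2) * (u * (2 - u)) - d ^+ 2) =
    (w + d * (1 - m)) ^+ 2 + d ^+ 2 * (1 - w ^+ 2 - (1 - m) ^+ 2).
  by rewrite /m /w; field.
rewrite addr_ge0 ?sqr_ge0// mulr_ge0 ?sqr_ge0// /m /w; nra.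
Qed.

Lemma weight1_01 : 0 <= (1 : R) <= 1.
Proof. by rewrite ler01 lexx. Qed.

Definition constant_arm (x : R) : arm R := Arm x x weight1_01.

Lemma expect_constant x (f : R -> R) : expect (constant_arm x) f = f x.
Proof. by rewrite /expect/=; ring. Qed.

Lemma subgaussian1_constant x : subgaussian1 (arm_law (constant_arm x)).
Proof.
apply: subgaussian1_arm_law => l; rewrite !expect_constant subrr mulr0 ler_expR.
by rewrite divr_ge0// sqr_ge0.
Qed.

End Rademacher.

(** * The lower bound *)

Section SumComparison.
Local Open Scope ring_scope.
Set Implicit Arguments.
Unset Strict Implicit.
Context {R : realDomainType} {I : finType}.
Implicit Types (J : {set I}) (f g : I -> R).

Lemma exists_lt_sum J f g :
  \sum_(j in J) f j < \sum_(j in J) g j -> exists2 j, j \in J & f j < g j.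
Proof.
move=> fg; apply/exists_inP; apply: contraTT fg => /exists_inPn gf.
by rewrite -leNgt; apply: ler_sum => j /gf; rewrite -leNgt.
Qed.

Lemma exists_le_sum J f g : J != finset.set0 ->
  \sum_(j in J) f j <= \sum_(j in J) g j -> exists2 j, j \in J & f j <= g j.
Proof.
move=> /set0Pn[k kJ] fg; apply/exists_inP; apply: contraTT fg => /exists_inPn gf.
rewrite -ltNge; apply: ltr_sum => [|j /gf]; last by rewrite -ltNge.
by apply/hasP; exists k; rewrite ?mem_index_enum.
Qed.

End SumComparison.

Section LowerBound.
Local Open Scope ring_scope.
Set Implicit Arguments.
Unset Strict Implicit.
Context {R : realType} {K : nat}.
Variables (m : 'I_K -> nat) (T : nat) (pi : policy R K).
Hypotheses (K2 : (2 <= K)%N) (T1 : (1 <= T)%N) (vpi : valid_policy pi).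
Implicit Types (A B : 'I_K -> arm R) (j : 'I_K) (J : {set 'I_K}).

Let arms t := schedule (offline_arms m) t pi.

Definition regret A : R := \sum_(t < T) run A (arms t) (round_regret A pi) [::] [::].

Definition pull_prob A j (t : nat) : R := run A (arms t) (fun s xs => pi s xs j) [::] [::].

(** Offline samples of [j] are counted too; round [t] itself is not. *)
Definition prior_pulls A j (t : nat) : R := pulls A j (arms t) [::] [::].

Let varms t : valid_policies (arms t).
Proof. exact: valid_schedule. Qed.

Let pi01 s xs j : 0 <= pi s xs j <= 1.
Proof.
rewrite policy_ge0//= -(policy_sum1 s xs vpi) (bigD1 j)//= lerDl.
by apply: sumr_ge0 => i _; exact: policy_ge0.
Qed.

Lemma regret_le_minimax A : (forall i, subgaussian1 (arm_law (A i))) ->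
  ((regret A)%:E <= minimax_regret m T pi)%E.
Proof.
move=> sA; apply: ereal_sup_ubound.
by exists (fun i => arm_law (A i)) => //; exact: expected_regretE.
Qed.

Lemma minimax_regret_ge0 : (0 <= minimax_regret m T pi)%E.
Proof.
apply: (le_trans _ (regret_le_minimax (fun=> subgaussian1_constant 0))).
rewrite lee_fin; apply: sumr_ge0 => t _.
rewrite -[leLHS](run_cst (fun=> constant_arm 0) 0 [::] [::] (varms t)).
by apply: run_le => // s xs; exact: round_regret_ge0.
Qed.

(** Round [t < T] is preceded by at most [T - 1] online pulls: this is the source of [T - 1] in the
    denominator. *)
Lemma sum_prior_pulls A J t : (t < T)%N ->
  \sum_(j in J) prior_pulls A j t <= (denomJ m T J)%:R.
Proof.
move=> tT; apply: (le_trans (sum_pulls_schedule _ _ _ _ vpi _ _)).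
by rewrite count_offline_arms ler_nat /denomJ addnC leq_add2r -ltnS prednK.
Qed.

Lemma run_not_pulled A j t :
  run A (arms t) (fun s xs => 1 - pi s xs j) [::] [::] = 1 - pull_prob A j t.
Proof.
have -> : (fun s xs => 1 - pi s xs j) = (fun s xs => -1 * pi s xs j + 1).
  by apply/funext => s; apply/funext => xs; rewrite mulN1r addrC.
by rewrite run_affine// mulN1r addrC.
Qed.

Lemma regret_ge A j c :
  (forall i, i != j -> c <= expect (A j) id - expect (A i) id) ->
  \sum_(t < T) c * (1 - pull_prob A j t) <= regret A.
Proof.
move=> gapc; apply: ler_sum => t _.
rewrite -run_not_pulled -[leLHS]addr0 -run_affine//.
apply: run_le => // s xs; rewrite addr0; apply: round_regret_ge => // i ij.
exact: (le_trans (gapc i ij) (gap_ge _ _ _)).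
Qed.

Lemma regret_ge_arm A j k c : 0 <= c -> c <= expect (A k) id - expect (A j) id ->
  \sum_(t < T) c * pull_prob A j t <= regret A.
Proof.
move=> c0 gapc; apply: ler_sum => t _; rewrite -[leLHS]addr0 -run_affine//.
apply: run_le => // s xs; rewrite addr0.
apply: (le_trans _ (round_regret_ge_arm _ vpi j _ _)).
by rewrite ler_wpM2r ?policy_ge0//; exact: (le_trans gapc (gap_ge _ _ _)).
Qed.

Lemma pull_prob01 A j t : 0 <= pull_prob A j t <= 1.
Proof. by apply: run01 => // s xs; exact: pi01. Qed.

Lemma sum_pull_prob_le1 A J t : \sum_(j in J) pull_prob A j t <= 1.
Proof.
rewrite -run_sum -[leRHS](run_cst A 1 [::] [::] (varms t)); apply: run_le => // s xs.
rewrite -(policy_sum1 s xs vpi) [leRHS](bigID (mem J))/= lerDl.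
by apply: sumr_ge0 => i _; exact: policy_ge0.
Qed.

(** [run_change_arm] applied to the probability of not choosing [j], with [phi] removed by
    [u <= phi u] on the left and [phi u <= 2 u] on the right. *)
Lemma pull_prob_change A B j (b01 : 0 <= (0 : R) <= 2^-1) d (d01 : 0 <= d <= 2^-1) t :
  (forall i, i != j -> B i = A i) -> A j = biased b01 -> B j = biased d01 ->
  1 - pull_prob A j t - d ^+ 2 * prior_pulls A j t <= 2 * (1 - pull_prob B j t).
Proof.
move=> AB Aj Bj; rewrite -!run_not_pulled.
have G01 (s : seq 'I_K) (xs : seq R) : 0 <= 1 - pi s xs j <= 1.
  by have := pi01 s xs j; lra.
apply: (@le_trans _ _ (phi (run B (arms t) (fun s xs => 1 - pi s xs j) [::] [::]))).
  apply: (le_trans _ (run_change_arm (l := d ^+ 2) AB _ (varms t) G01 [::] [::])).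
    rewrite lerD2r; apply: run_le => // s xs.
    by have := G01 s xs; rewrite /phi; set u := 1 - _; nra.
  by move=> f f01; rewrite Aj Bj; exact: change_biased.
by rewrite /phi; have := sqr_ge0 (run B (arms t) (fun s xs => 1 - pi s xs j) [::] [::]); nra.
Qed.

Lemma other_arm j : exists k : 'I_K, k != j.
Proof.
have /card_gt0P[k] : (0 < #|[set~ j]|)%N by rewrite cardsC1 card_ord -subn1 subn_gt0.
by rewrite !inE; exists k.
Qed.

Lemma last_le_sum (f : nat -> R) : (forall t, 0 <= f t) ->
  f T.-1 <= \sum_(t < T) f t.
Proof.
move=> f0; have ltT : (T.-1 < T)%N by rewrite prednK.
by rewrite (bigD1 (Ordinal ltT))//= lerDl sumr_ge0.
Qed.

(* Some arm of [J] is unseen with positive probability before the last round,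
   so that its mean can be sent to +oo or to -oo. *)
Lemma minimax_regret_infinite J : (denomJ m T J < #|J|)%N ->
  minimax_regret m T pi = +oo%E.
Proof.
move=> DJ; pose A := fun _ : 'I_K => constant_arm (0 : R).
have [j jJ unseen] : exists2 j, j \in J & prior_pulls A j T.-1 < 1.
  apply: exists_lt_sum; apply: (le_lt_trans (sum_prior_pulls _ _ _)).
    by rewrite prednK.
  by rewrite sumr_const ltr_nat.
have [k kj] := other_arm j.
apply/eqyP => c c0; set u := prior_pulls A j T.-1 in unseen.
(* The regrets under [+L] and [-L] will sum to at least [L (1 - u) = 2 c], so one of them reaches
   [c]. *)
pose L := 2 * c / (1 - u).
have L0 : 0 <= L by rewrite divr_ge0 ?subr_ge0 ?ltW// mulr_gt0.
pose A' (x : R) i := constant_arm (if i == j then x else 0).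
have subA' x : ((regret (A' x))%:E <= minimax_regret m T pi)%E.
  by apply: regret_le_minimax => i; exact: subgaussian1_constant.
have off x i : i != j -> A' x i = A i by rewrite /A'; case: eqP.
have G01 (s : seq 'I_K) (xs : seq R) : 0 <= 1 - pi s xs j <= 1.
  by have := pi01 s xs j; lra.
have := run_unseen_arm (off L) (off (- L)) (varms T.-1) G01 [::] [::].
rewrite run_not_pulled -/(prior_pulls A j T.-1) -/u.
have -> : (fun s xs => 1 - (1 - pi s xs j)) = (fun s xs => pi s xs j).
  by apply/funext => s; apply/funext => xs; rewrite subKr.
rewrite -/(pull_prob (A' (- L)) j T.-1) => sum_ge.
(* Under [+L] avoiding [j] in the last round costs [L]; under [-L] choosing [j] does. *)
have hB : L * (1 - pull_prob (A' L) j T.-1) <= regret (A' L).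
  apply: (le_trans (last_le_sum (f := fun t => L * (1 - pull_prob (A' L) j t)) _)).
    by move=> t; rewrite mulr_ge0// subr_ge0; case/andP: (pull_prob01 (A' L) j t).
  apply: regret_ge => i ij.
  by rewrite !expect_constant eqxx (negbTE ij) subr0.
have hC : L * pull_prob (A' (- L)) j T.-1 <= regret (A' (- L)).
  apply: (le_trans (last_le_sum (f := fun t => L * pull_prob (A' (- L)) j t) _)).
    by move=> t; rewrite mulr_ge0//; case/andP: (pull_prob01 (A' (- L)) j t).
  apply: (regret_ge_arm (k := k)) => //.
  by rewrite !expect_constant eqxx (negbTE kj) sub0r opprK.
have Lu : L * (1 - u) = 2 * c by rewrite /L divfK// subr_eq0 gt_eqF.
have := ler_wpM2l L0 sum_ge; rewrite Lu => c2.
have [cB|cB] := leP c (regret (A' L)).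
  by apply: (le_trans _ (subA' L)); rewrite lee_fin.
by apply: (le_trans _ (subA' (- L))); rewrite lee_fin; lra.
Qed.

(** Averaging over [j] in [J]: in each round the pull probabilities sum to at most 1 and the
    divergence costs to at most [|J| / 4], and [|J| - 1 - |J| / 4 >= |J| / 4] once [|J| >= 2]. *)
Lemma minimax_regret_ge_many J d : (1 < #|J|)%N -> 0 <= d <= 2^-1 ->
  d ^+ 2 * (denomJ m T J)%:R <= #|J|%:R / 4 ->
  ((scale * d * T%:R / 8)%:E <= minimax_regret m T pi)%E.
Proof.
move=> J1 d01 dD; have b01 : 0 <= (0 : R) <= 2^-1 by lra.
pose A (i : 'I_K) := biased b01; pose B j i := if i == j then biased d01 else biased b01.
have J0 : J != finset.set0 by rewrite -card_gt0 ltnW.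
have sd0 : 0 <= scale * d.
  by apply: mulr_ge0; [exact: ltW scale_gt0|case/andP: (d01)].
have [j jJ le_regret] : exists2 j, j \in J & scale * d * T%:R / 8 <= regret (B j).
  apply: exists_le_sum => //.
  apply: (@le_trans _ _ (\sum_(j in J) \sum_(t < T) scale * d / 2 *
      (1 - pull_prob A j t - d ^+ 2 * prior_pulls A j t))).
    rewrite exchange_big/= sumr_const.
    apply: (@le_trans _ _ (\sum_(t < T) scale * d / 2 * (#|J|%:R / 4))).
      rewrite sumr_const card_ord -[leLHS]mulr_natr -[leRHS]mulr_natr.
      by rewrite le_eqVlt; apply/orP; left; apply/eqP; field.
    apply: ler_sum => t _; rewrite -mulr_sumr ler_wpM2l ?divr_ge0//.
    rewrite !sumrB sumr_const -mulr_sumr.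
    have h1 := sum_pull_prob_le1 A J t.
    have h2 := ler_wpM2l (sqr_ge0 d) (sum_prior_pulls A J (ltn_ord t)).
    have h3 : 2 <= #|J|%:R :> R by rewrite ler_nat.
    by lra.
  apply: ler_sum => j jJ.
  apply: (@le_trans _ _ (\sum_(t < T) scale * d * (1 - pull_prob (B j) j t))).
    apply: ler_sum => t _.
    have h : 1 - pull_prob A j t - d ^+ 2 * prior_pulls A j t <=
        2 * (1 - pull_prob (B j) j t).
      apply: (pull_prob_change (b01 := b01) (d01 := d01)) => //.
        by move=> i ij; rewrite /B (negbTE ij).
      by rewrite /B eqxx.
    by have := ler_wpM2l sd0 h; lra.
  apply: regret_ge => i ij.
  by rewrite /B eqxx (negbTE ij) !expect_biased mulr0 subr0.
apply: (le_trans _ (regret_le_minimax _)); first by rewrite lee_fin; exact: le_regret.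
by move=> i; rewrite /B; case: eqP => _; exact: subgaussian1_biased.
Qed.

(* For a singleton [J] the mean of the other arms sits halfway between the two
   candidate means of the arm of [J]. *)
Lemma minimax_regret_ge_one j d : 0 <= d <= 2^-1 ->
  d ^+ 2 * (denomJ m T [set j])%:R <= 4^-1 ->
  ((scale * d * T%:R / 8)%:E <= minimax_regret m T pi)%E.
Proof.
move=> d01 dD; have b01 : 0 <= (0 : R) <= 2^-1 by lra.
have h01 : 0 <= d / 2 <= 2^-1 by lra.
pose A i := if i == j then biased b01 else biased h01.
pose B i := if i == j then biased d01 else biased h01.
have [k kj] := other_arm j.
have subA i : subgaussian1 (arm_law (A i)).
  by rewrite /A; case: eqP => _; exact: subgaussian1_biased.
have subB i : subgaussian1 (arm_law (B i)).
  by rewrite /B; case: eqP => _; exact: subgaussian1_biased.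
have sd0 : 0 <= scale * d.
  by apply: mulr_ge0; [exact: ltW scale_gt0|case/andP: (d01)].
have hA : \sum_(t < T) scale * d / 2 * pull_prob A j t <= regret A.
  apply: (regret_ge_arm (k := k)); first by rewrite divr_ge0.
  by rewrite /A eqxx (negbTE kj) !expect_biased mulr0 subr0 mulrA.
have hB : \sum_(t < T) scale * d / 2 * (1 - pull_prob B j t) <= regret B.
  apply: regret_ge => i ij.
  rewrite /B eqxx (negbTE ij) !expect_biased.
  by rewrite le_eqVlt; apply/orP; left; apply/eqP; field.
(* The weight 2 on [B] matches the factor 2 of [pull_prob_change]; the divergence cost, at most 1/4,
   leaves 3/4 per round. *)
have : 3 * (scale * d * T%:R / 8) <= regret A + 2 * regret B.
  apply: (le_trans _ (lerD hA (ler_wpM2l _ hB))) => //.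
  apply: (@le_trans _ _ (\sum_(t < T) scale * d / 2 * (3 / 4))).
    rewrite sumr_const card_ord -[leRHS]mulr_natr.
    by rewrite le_eqVlt; apply/orP; left; apply/eqP; field.
  rewrite mulr_sumr -big_split/=; apply: ler_sum => t _.
  have h1 : 1 - pull_prob A j t - d ^+ 2 * prior_pulls A j t <=
      2 * (1 - pull_prob B j t).
    apply: (pull_prob_change (b01 := b01) (d01 := d01)).
    - by move=> i ij; rewrite /A /B (negbTE ij).
    - by rewrite /A eqxx.
    - by rewrite /B eqxx.
  have := sum_prior_pulls A [set j] (ltn_ord t); rewrite big_set1 => h2.
  have h3 : 3 / 4 <= pull_prob A j t + 2 * (1 - pull_prob B j t).
    by have := ler_wpM2l (sqr_ge0 d) h2; lra.
  by have := ler_wpM2l sd0 h3; lra.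
move=> sum_ge; have [cA|cA] := leP (scale * d * T%:R / 8) (regret A).
  by apply: (le_trans _ (regret_le_minimax subA)); rewrite lee_fin.
by apply: (le_trans _ (regret_le_minimax subB)); rewrite lee_fin; lra.
Qed.

Lemma minimax_regret_ge J :
  ((T%:R * Num.sqrt (#|J|%:R / (denomJ m T J)%:R) / 31)%:E <= minimax_regret m T pi)%E.
Proof.
(* The first case includes a nonempty [J] with zero denominator, where the real quotient takes the
   value 0. *)
have [DJ|JD] := ltnP (denomJ m T J) #|J|.
  by rewrite (minimax_regret_infinite DJ) leey.
have [J0|J0] := posnP #|J|.
  by rewrite J0 mul0r sqrtr0 mulr0 mul0r minimax_regret_ge0.
have D0 : 0 < (denomJ m T J)%:R :> R by rewrite ltr0n (leq_trans J0).
set q : R := #|J|%:R / (denomJ m T J)%:R.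
have q0 : 0 <= q by rewrite divr_ge0.
have q1 : q <= 1 by rewrite ler_pdivrMr// mul1r ler_nat.
have sq1 : Num.sqrt q <= 1 by rewrite -sqrtr1 ler_wsqrtr.
(* The bias with [d^2 D = |J| / 4], where [D] is the denominator; [q <= 1] makes it at most 1/2. *)
pose d := Num.sqrt q / 2.
have d01 : 0 <= d <= 2^-1.
  by rewrite divr_ge0 ?sqrtr_ge0//= ler_pdivrMr// mulVf.
have dD : d ^+ 2 * (denomJ m T J)%:R = #|J|%:R / 4.
  rewrite exprMn sqr_sqrtr// /q mulrAC divfK ?gt_eqF//.
  by field.
have -> : T%:R * Num.sqrt q / 31 = scale * d * T%:R / 8.
  by rewrite /scale /d; field.
have [J1|J1] := ltnP 1 #|J|; first by apply: minimax_regret_ge_many J1 d01 _; rewrite dD.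
have /cards1P[j Jj] : #|J| == 1%N by rewrite eqn_leq J1.
apply: (minimax_regret_ge_one (j := j)) => //.
by rewrite -Jj dD Jj cards1 mul1r.
Qed.

End LowerBound.

Theorem theorem2 (R : realType) (K : nat) (hK : (2 <= K)%N)
    (m : 'I_K -> nat) (T : nat) (hT : (1 <= T)%N) (pi : policy R K) :
  valid_policy pi ->
  lower_bound R m T <= minimax_regret m T pi.
Proof.
move=> vpi; rewrite /lower_bound; case: ifPn => [/existsP[J /andP[J0 /eqP D0]]|_].
  by rewrite (@minimax_regret_infinite _ _ _ _ _ hK hT vpi J)// D0 card_gt0.
(* The bound passes through a maximum, so it is proved for 0 and for each [J] separately. *)
elim/big_ind: _ => [|x y hx hy|J _].
- by rewrite sqrtr0 mulr0 mul0r; exact: minimax_regret_ge0.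
- by rewrite /Num.max; case: ifP.
- exact: minimax_regret_ge.
Qed.
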